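(* (i) For every fixed real $\varepsilon>0$ there is a constant $C_\varepsilon>0$ such that, for all positive integers $c,d$ with $d\ge(1+\varepsilon)c$, $$\nu(c,d)\le \frac{d}{c}+C_\varepsilon\,\log(d+2)\,\log\log(d+3).$$ (Equivalently, in asymptotic notation, $\nu(c,d)\le d/c+O_\varepsilon(\log d\log\log d)$ through the range $d\ge(1+\varepsilon)c$.) (ii) Moreover, there is an absolute constant $C>0$ such that for all positive integers $c,d$ with $d\ge 2c$, $$\nu(c,d)\le \frac{d}{c}+C\,\log(d+2)\,\log\log(d+3).$$
   Context: For a finite poset $P$, $e(P)$ denotes the number of linear extensions of $P$, with $e(\varnothing)=1$. For $x\in P$, $P-x$ is the induced subposet on $P\setminus\{x\}$, and $\rho(P,x):=e(P)/e(P-x)$. For positive integers $c\le d$, $$\nu(c,d):=\min\{\,|P| : P \text{ is a finite poset and there is } x\in P \text{ with } \rho(P,x)=d/c\,\}.$$ The set over which the minimum is taken is nonempty for all positive integers $c\le d$; an upper bound on $\nu(c,d)$ means that there is a finite poset $P$ of at most that size and an $x\in P$ with $\rho(P,x)=d/c$. Here $\log$ is the natural logarithm. *)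

(* Defs.v *)
From HB Require Import structures.
From mathcomp Require Import all_boot all_order all_algebra.
From mathcomp Require Import reals exp.

Set Implicit Arguments.
Unset Strict Implicit.
Unset Printing Implicit Defensive.

Import Order.TTheory GRing.Theory Num.Theory.

Local Open Scope ring_scope.

(* Linear extensions as order-preserving labellings by 0, ..., |P| - 1; an
   injection into 'I_#|P| is automatically a bijection. *)
Definition linear_extension (disp : Order.disp_t) (P : finPOrderType disp)
    (f : {ffun P -> 'I_#|P|}) : bool :=
  injectiveb f && [forall y, forall z, (y < z)%O ==> (f y < f z)%N].

Definition num_linext (disp : Order.disp_t) (P : finPOrderType disp) : nat :=
  #|[set f : {ffun P -> 'I_#|P|} | linear_extension f]|.

(* P - x, with the order induced from P. *)
Definition poset_del (disp : Order.disp_t) (P : finPOrderType disp) (x : P) :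
  Type := {y : P | y != x}.

HB.instance Definition _ (disp : Order.disp_t) (P : finPOrderType disp)
  (x : P) := SubFinite.on (poset_del x).
HB.instance Definition _ (disp : Order.disp_t) (P : finPOrderType disp)
  (x : P) := [SubChoice_isSubPOrder of poset_del x by <: with disp].

Definition rho (disp : Order.disp_t) (P : finPOrderType disp) (x : P) : rat :=
  (num_linext P)%:R / (num_linext (poset_del x))%:R.

Definition nu_size (c d n : nat) : Prop :=
  exists (disp : Order.disp_t) (P : finPOrderType disp) (x : P),
    #|P| = n /\ rho x = d%:R / c%:R.

(* "nu(c, d) exists and equals n". The minimum is a relation rather than a
   function so that no default value is needed for an empty set of sizes. *)
Definition is_nu (c d n : nat) : Prop :=
  nu_size c d n /\ forall m : nat, nu_size c d m -> (n <= m)%N.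

(* Main.v *)
Require Import Defs.
From HB Require Import structures.
From mathcomp Require Import all_boot all_order all_algebra.
From mathcomp Require Import boolp reals exp zify ring lra.
Import Order.TTheory GRing.Theory Num.Theory.

Set Implicit Arguments.
Unset Strict Implicit.
Unset Printing Implicit Defensive.

(* Let [x] be minimal in [P], with [rho(P, x) = a / b].  Adding a new element [y]
   below everything except [x] gives a poset [P'] with [rho(P', x) = a / b + 1]
   and [rho(P', y) = 1 + b / a], so running the Euclidean algorithm backwards
   realizes [a / b] with as many elements as the sum of the partial quotients of
   [a / b].  Placing such a [P] above the dual of a second one [Q], with the two
   distinguished elements identified, gives ratio [rho(P) + rho(Q) - 1].  Hence
   it suffices to write [d - c = al + be] with the partial quotients of [al / c]
   and [be / c] having sums [O(log c log log c)]; by pigeonhole such a splitting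
   exists as soon as this holds for all but a small fraction of the residues
   modulo [c].  A partial quotient at least [k] of [a / c] produces a denominator
   [q <= c / k] with [q a = +- r] modulo [c] and [0 < r <= c / (k q)], which for
   given [q] and [k] happens for at most [2 c / (k q)] residues [a].  Summing over
   [q <= c] and [k <= T] with [T = K (1 + log c)] bounds the sum of the truncated
   quotients by [O(log c log T)] on average, and truncation affects only a
   fraction [O(1 / K)] of the residues. *)

Local Open Scope nat_scope.

(** * Counting linear extensions of subsets *)

(** Linear extensions are encoded as lists, and posets as subsets of one fixed type, so that
    deleting an element does not change the type. *)
Definition linext (T : finType) (lt : rel T) (A : {set T}) : nat :=
  count (pairwise (fun y z => ~~ lt z y)) (permutations (enum A)).

Definition minl (T : finType) (lt : rel T) (A : {set T}) (x : T) : bool :=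
  (x \in A) && [forall z in A, ~~ lt z x].

Section LinearExtensions.
Variables (T : finType) (lt : rel T).
Hypothesis lt_irr : irreflexive lt.
Implicit Types (A B : {set T}) (x y z : T).

Lemma perm_enum_rem A x : x \in A -> perm_eq (rem x (enum A)) (enum (A :\ x)).
Proof.
move=> xA; apply: uniq_perm; rewrite ?rem_uniq ?enum_uniq // => y.
by rewrite rem_filter ?enum_uniq // mem_filter !mem_enum !inE.
Qed.

Lemma linext0 : linext lt set0 = 1.
Proof. by rewrite /linext enum_set0. Qed.

Lemma linext_rec A : A != set0 ->
  linext lt A = \sum_(x | minl lt A x) linext lt (A :\ x).
Proof.
move=> A0; rewrite /linext.
have sA : 0 < size (enum A) by rewrite -cardE card_gt0.
rewrite (permP (permutationsE sA)) count_flatten -map_comp sumnE big_map.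
rewrite undup_id ?enum_uniq // big_enum_cond /=.
rewrite [LHS]big_mkcond [RHS]big_mkcond /=.
apply: eq_bigr => x _; rewrite /minl andbT; case: ifP => // xA /=.
rewrite count_map -(permP (perm_permutations (perm_enum_rem xA))).
have memA s : s \in permutations (rem x (enum A)) -> s =i A :\ x.
  rewrite mem_permutations => /perm_mem sE y.
  by rewrite sE (perm_mem (perm_enum_rem xA)) mem_enum.
case: ifP => [/forall_inP minx|/negP nminx].
  apply: eq_in_count => s /memA sE /=.
  have -> // : all (fun z => ~~ lt z x) s.
  by apply/allP => z; rewrite sE !inE => /andP[_ /minx].
rewrite -[RHS](count_pred0 (permutations (rem x (enum A)))).
apply: eq_in_count => s /memA sE /=; apply/negP => /andP[/allP minx _].
apply: nminx; apply/forall_inP => z zA; have [->|zx] := eqVneq z x.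
  by rewrite lt_irr.
by apply: minx; rewrite sE !inE zx.
Qed.

Lemma linext1 x : linext lt [set x] = 1.
Proof. by rewrite /linext enum_set1. Qed.


(** Either [x] comes first, or a minimal element of [C] does: it remains minimal after [x] is added
    because [x] is not below it. *)
Lemma linext_recU1 (C : {set T}) x :
    x \notin C -> (forall c, minl lt C c -> ~~ lt x c) ->
  linext lt (x |: C) = [forall c in C, ~~ lt c x] * linext lt C
                       + \sum_(y | minl lt C y) linext lt (x |: C :\ y).
Proof.
move=> xC ltxC; rewrite linext_rec; last by apply/set0Pn; exists x; rewrite !inE eqxx.
rewrite (bigID (pred1 x)) /=; congr (_ + _).
  have -> : [forall c in C, ~~ lt c x] = minl lt (x |: C) x.
    rewrite /minl !inE eqxx /=; apply/forall_inP/forall_inP => h z.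
      by rewrite !inE => /orP[/eqP->|/h//]; rewrite lt_irr.
    by move=> zC; apply: h; rewrite !inE zC orbT.
  case: (boolP (minl lt (x |: C) x)) => [mx|/negPf mx]; last first.
    by rewrite big1 // => y /andP[+ /eqP xy]; rewrite xy mx.
  rewrite (eq_bigl (pred1 x)) ?big_pred1_eq ?mul1n ?setU1K // => y /=.
  by case: eqVneq => [->|]; rewrite ?mx ?andbF.
apply: eq_big => [y|y /andP[my yx]].
  rewrite /minl !inE; case: eqVneq => /= [->|yx]; first by rewrite andbF (negPf xC).
  rewrite andbT; case yC: (y \in C) => //=; apply/forall_inP/forall_inP => h z.
    by move=> zC; apply: h; rewrite !inE zC orbT.
  rewrite !inE => /orP[/eqP->|/h//]; apply: ltxC; rewrite /minl yC /=.
  by apply/forall_inP.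
congr linext; apply/setP => z; rewrite !inE.
by case: (eqVneq z x) => // ->; rewrite eq_sym yx.
Qed.

Lemma minl_ordinal_sum A B : A != set0 ->
    (forall a b, a \in A -> b \in B -> lt a b && ~~ lt b a) ->
  minl lt (A :|: B) =1 minl lt A.
Proof.
move=> A0 ltAB x; rewrite /minl !inE; case xA: (x \in A) => /=.
  apply/forall_inP/forall_inP => [h z zA|h z]; first by rewrite h ?inE ?zA.
  by rewrite !inE => /orP[/h//|zB]; case/andP: (ltAB _ _ xA zB).
apply/negP => /andP[xB /forall_inP h].
have /set0Pn[a aA] := A0.
by move: (h a); rewrite inE aA => /(_ isT); case/andP: (ltAB _ _ aA xB) => ->.
Qed.

Lemma setUD1l A B x : x \notin B -> (A :|: B) :\ x = A :\ x :|: B.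
Proof.
move=> xB; apply/setP => z; rewrite !inE; case: eqVneq => [->|] //.
by rewrite (negPf xB).
Qed.

Lemma linext_ordinal_sum A B :
    (forall a b, a \in A -> b \in B -> lt a b && ~~ lt b a) ->
  linext lt (A :|: B) = linext lt A * linext lt B.
Proof.
have [n] := ubnP #|A|; elim: n A => // n IHn A leAn ltAB.
have [->|A0] := eqVneq A set0; first by rewrite set0U linext0 mul1n.
rewrite linext_rec; last by apply: contraNneq A0 => /eqP; rewrite setU_eq0 => /andP[].
rewrite (linext_rec A0) big_distrl /= (eq_bigl _ _ (minl_ordinal_sum A0 ltAB)).
apply: eq_bigr => x /andP[xA _].
have xB : x \notin B by apply/negP => /(ltAB _ _ xA); rewrite lt_irr.
rewrite setUD1l // IHn //.
  by rewrite -ltnS (leq_trans _ leAn) // ltnS [#|A|](cardsD1 x) xA.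
by move=> a b; rewrite !inE => /andP[_ aA] /ltAB; exact.
Qed.

(* The element [x] sits inside the block of [A], inside the block of [B], or
   between the two blocks; the last case is counted twice on the right. *)
Lemma linext_glue A B x :
    (forall a b, a \in A -> b \in B -> lt a b && ~~ lt b a) ->
    x \notin A -> x \notin B ->
    (forall a, a \in A -> ~~ lt x a) -> (forall b, b \in B -> ~~ lt b x) ->
  linext lt (x |: (A :|: B)) + linext lt A * linext lt B =
  linext lt (x |: A) * linext lt B + linext lt A * linext lt (x |: B).
Proof.
have [n] := ubnP #|A|; elim: n A => // n IHn A leAn ltAB xA xB ltxA ltBx.
have [->|A0] := eqVneq A set0.
  by rewrite set0U setU0 linext0 linext1 !mul1n addnC.
have xAB : x \notin A :|: B by rewrite inE negb_or xA.
rewrite (linext_recU1 xAB); last first.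
  by move=> c; rewrite (minl_ordinal_sum A0 ltAB) => /andP[/ltxA].
rewrite (linext_recU1 xA); last by move=> c /andP[/ltxA].
rewrite (eq_bigl _ _ (minl_ordinal_sum A0 ltAB)) linext_ordinal_sum //.
have -> : [forall c in A :|: B, ~~ lt c x] = [forall c in A, ~~ lt c x].
  apply/forall_inP/forall_inP => h z zA; first by rewrite h // inE zA.
  by move: zA; rewrite inE => /orP[/h|/ltBx].
(* The terms with [x] first agree on both sides; the others match for each first element [y] of [A],
   by induction on [A :\ y]. *)
rewrite mulnDl -mulnA -!addnA; congr (_ + _).
rewrite (linext_rec A0) !big_distrl -!big_split /=.
apply: eq_bigr => y /andP[yA _].
have yB : y \notin B by apply/negP => /(ltAB _ _ yA); rewrite lt_irr.
rewrite setUD1l // IHn ?inE ?(negPf xA) ?andbF //.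
- by rewrite -ltnS (leq_trans _ leAn) // ltnS [#|A|](cardsD1 y) yA.
- by move=> a b; rewrite !inE => /andP[_ aA] /ltAB; exact.
- by move=> a; rewrite !inE => /andP[_ /ltxA].
Qed.

Lemma linext_rev A : linext (fun y z => lt z y) A = linext lt A.
Proof.
rewrite /linext.
have /permP <- : perm_eq (map rev (permutations (enum A))) (permutations (enum A)).
  apply: uniq_perm; rewrite ?(map_inj_uniq (can_inj revK)) ?permutations_uniq // => s.
  rewrite -{1}[s]revK mem_map ?mem_permutations; last exact: can_inj revK.
  by rewrite perm_rev.
rewrite count_map; apply: eq_count => s /=.
elim: s => //= x s IH.
by rewrite rev_cons -cats1 pairwise_cat allrel1r all_rev IH /= andbT.
Qed.
End LinearExtensions.

(** Agreement of the two orders is asked only on [A], because a glued poset may copy its constituent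
    faithfully only away from the distinguished element. *)
Lemma linext_imset (T U : finType) (lt : rel T) (lt' : rel U) (h : T -> U)
    (A : {set T}) :
    irreflexive lt -> irreflexive lt' -> {in A &, injective h} ->
    {in A &, forall y z, lt' (h y) (h z) = lt y z} ->
  linext lt' (h @: A) = linext lt A.
Proof.
move=> irr irr'; have [n] := ubnP #|A|; elim: n A => // n IHn A leAn injh hlt.
have [->|A0] := eqVneq A set0; first by rewrite imset0 !linext0.
rewrite !linext_rec ?imset_eq0 // big_mkcondr /= big_imset //= -big_mkcondr /=.
apply: eq_big => [x|x /andP[xA _]].
  rewrite /minl; case xA: (x \in A) => //=.
  apply/forall_inP/forall_inP => m z.
    by move=> zA; rewrite -hlt // m ?imset_f.
  by case/imsetP => y yA ->; rewrite hlt ?m.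
have -> : (h @: A) :\ h x = h @: (A :\ x).
  apply/setP => u; rewrite !inE; apply/andP/imsetP => [[ux /imsetP[y yA uE]]|[y]].
    by exists y => //; rewrite !inE yA andbT; apply: contraNneq ux => <-; rewrite uE.
  rewrite !inE => /andP[yx yA] ->; rewrite imset_f // (inj_in_eq injh) //.
apply: IHn; first by rewrite -ltnS (leq_trans _ leAn) // ltnS [#|A|](cardsD1 x) xA.
  by move=> y z; rewrite !inE => /andP[_ yA] /andP[_ zA]; apply: injh.
by move=> y z; rewrite !inE => /andP[_ yA] /andP[_ zA]; apply: hlt.
Qed.

Lemma num_linextE (disp : Order.disp_t) (P : finPOrderType disp) :
  num_linext P = linext (fun y z : P => (y < z)%O) [set: P].
Proof.
rewrite /num_linext /linext enum_setT -enumT.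
(* An element is labelled by its position; the default [enum_rank y] is never reached for a list in
   [SS]. *)
pose F (s : seq P) : {ffun P -> 'I_#|P|} :=
  [ffun y => insubd (enum_rank y) (index y s)].
rewrite -size_filter -(size_map F).
set SS := filter _ _.
have memSS s : s \in SS -> [/\ forall y, y \in s, uniq s, size s = #|P|
    & pairwise (fun y z => ~~ (z < y)%O) s].
  rewrite mem_filter mem_permutations => /andP[pw ps]; split=> //.
  - by move=> y; rewrite (perm_mem ps) mem_enum.
  - by rewrite (perm_uniq ps) enum_uniq.
  - by rewrite (perm_size ps) -cardE.
have valF s y : s \in SS -> F s y = index y s :> nat.
  move=> /memSS[sall _ szs _]; rewrite ffunE insubdK //.
  by rewrite unfold_in -szs index_mem.
have injF : {in SS &, injective F}.
  move=> s t sS tS eqF; have [sall us szs _] := memSS _ sS.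
  have [tall ut szt _] := memSS _ tS.
  case: (s =P [::]) => [s0|/eqP]; first by move: szt; rewrite -szs s0 => /size0nil.
  case def_s: s => [//|x0 s'] _; rewrite -def_s; apply: (@eq_from_nth _ x0).
    by rewrite szs.
  move=> i lti; have := valF s (nth x0 s i) sS.
  rewrite eqF valF // index_uniq // => eqi.
  by rewrite -[LHS](nth_index x0 (tall _)) eqi.
have <- : #|map F SS| = size (map F SS).
  apply/card_uniqP; rewrite map_inj_in_uniq // filter_uniq //.
  exact: permutations_uniq.
apply: eq_card => f; rewrite inE.
apply/andP/mapP => [[/injectiveP injf /forallP mf]|[s sS ->]].
  (* An injective labelling is bijective, and listing the elements by increasing label gives the
     preimage of [f]. *)
  have cf : #|P| = #|'I_#|P| | by rewrite card_ord.
  have [g fK gK] := inj_card_bij injf (eq_leq (esym cf)).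
  pose s := [seq g i | i <- enum 'I_#|P|].
  have us : uniq s by rewrite map_inj_uniq ?enum_uniq //; exact: can_inj gK.
  have sS : s \in SS.
    rewrite mem_filter mem_permutations; apply/andP; split; last first.
      apply: uniq_perm => //; first exact: enum_uniq.
      move=> y; rewrite mem_enum -(fK y) mem_map ?mem_enum //.
      exact: can_inj gK.
    rewrite pairwise_map.
    have : pairwise ltn (map val (enum 'I_#|P|)).
      by rewrite val_enum_ord -sorted_pairwise ?iota_ltn_sorted //; exact: ltn_trans.
    rewrite pairwise_map; apply: sub_pairwise => i j /= ltij.
    apply/negP => lt; have /forallP/(_ (g i))/implyP/(_ lt) := mf (g j).
    by rewrite !gK ltnNge (ltnW ltij).
  exists s => //; apply/ffunP => y; apply: ord_inj; rewrite valF //.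
  rewrite -[y in RHS]fK index_map; last exact: can_inj gK.
  by rewrite index_enum_ord.
have [sall us szs pw] := memSS _ sS.
split.
  apply/injectiveP => y z /(congr1 val) /=; rewrite !valF // => eqi.
  by rewrite -[y](nth_index y (sall y)) eqi nth_index.
apply/forallP => y; apply/forallP => z; apply/implyP => ltyz.
rewrite !valF // ltnNge; apply/negP.
rewrite leq_eqVlt => /orP[/eqP eqi|lti].
  by move: ltyz; rewrite -[y](nth_index y (sall y)) -eqi nth_index // ltxx.
move/(pairwiseP y): pw => /(_ (index z s) (index y s)).
by rewrite !inE !index_mem => /(_ (sall z) (sall y) lti); rewrite !nth_index // ltyz.
Qed.

Lemma finPOrder_of_rel (T : finType) (lt : rel T) (A : {set T}) (x : T) :
    irreflexive lt -> transitive lt -> x \in A ->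
  exists (P : finPOrderType (Order.Disp tt tt)) (p : P),
    [/\ #|P| = #|A|, num_linext P = linext lt A
      & num_linext (poset_del p) = linext lt (A :\ x)].
Proof.
move=> irr tr xA; pose S := {y : T | y \in A}.
pose ltS (y z : S) := lt (val y) (val z).
have irrS : irreflexive ltS by move=> y; exact: irr.
have trS : transitive ltS by move=> y z t; exact: tr.
pose M := Order.Lt_isPOrder.Build (Order.Disp tt tt) S irrS trS.
pose P : finPOrderType _ := HB.pack S M.
have ltP (y z : P) : (y < z)%O = lt (val y) (val z) by [].
exists P, (Sub x xA : P); split.
- by rewrite card_sig; apply: eq_card.
- rewrite num_linextE -(@linext_imset _ _ _ lt (val : P -> T)) //.
  + congr linext; apply/setP => y; apply/imsetP/idP => [[z _ ->]|yA].
      exact: (valP z).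
    by exists (Sub y yA : P); rewrite ?inE ?SubK.
  + by move=> y z _ _; exact: val_inj.
- rewrite num_linextE -(@linext_imset _ _ _ lt (fun u => val (val u : P) : T)) //.
  + congr linext; apply/setP => y; apply/imsetP/idP => [[z _ ->]|].
      by rewrite !inE (valP (val z : P)) andbT; exact: (valP z).
    rewrite !inE => /andP[yx yA].
    have yx' : (Sub y yA : P) != (Sub x xA : P) by apply: contra yx => /eqP[->].
    by exists (Sub (Sub y yA : P) yx').
  + by move=> y z _ _ /val_inj/val_inj.
Qed.

(** * Posets with prescribed ratios *)

(** The ratio [a / b] need not be reduced, so that two ratios can be glued over a common
    denominator. Minimality of [x] is what both the extension and the gluing steps rely on. *)
Definition realizable (n a b : nat) : Prop :=
  exists (T : finType) (lt : rel T) (x : T),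
    [/\ irreflexive lt, transitive lt, forall y, ~~ lt y x, #|T| = n
      & 0 < linext lt [set~ x] /\
        linext lt setT * b = linext lt [set~ x] * a].

Lemma realizable_one (b : nat) : realizable 1 b b.
Proof.
exists unit, (fun _ _ => false), tt; split => //; first exact: card_unit.
have -> : [set~ tt] = set0 by apply/setP => -[]; rewrite !inE.
have -> : [set: unit] = [set tt] by apply/setP => -[]; rewrite !inE.
by rewrite linext0 linext1.
Qed.

Definition below_except (T : finType) (lt : rel T) (x : T) : rel (option T) :=
  fun u v => match u, v with
  | Some y, Some z => lt y z
  | None, Some z => z != x
  | _, None => false
  end.

Section BelowExcept.
Variables (T : finType) (lt : rel T) (x : T).
Hypotheses (lt_irr : irreflexive lt) (lt_trans : transitive lt).
Hypothesis min_x : forall y, ~~ lt y x.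
Local Notation lt' := (below_except lt x).

Lemma below_except_irr : irreflexive lt'.
Proof. by case=> [y|] /=. Qed.

Lemma below_except_trans : transitive lt'.
Proof.
case=> [y|] [z|] [t|] //=; first exact: lt_trans.
by move=> _ lyt; apply: contraTneq lyt => ->; exact: min_x.
Qed.

Lemma linext_Some (A : {set T}) : linext lt' (Some @: A) = linext lt A.
Proof.
apply: linext_imset => //; first exact: below_except_irr.
by move=> y z _ _ [].
Qed.

Lemma linext_below_delNone : linext lt' [set~ None] = linext lt setT.
Proof.
rewrite -linext_Some; congr linext; apply/setP => -[y|]; rewrite !inE.
  by rewrite imset_f ?inE.
by apply/esym/negP => /imsetP[].
Qed.

Lemma linext_below_delSome : linext lt' [set~ Some x] = linext lt [set~ x].
Proof.
rewrite -linext_Some -[RHS]mul1n -(linext1 lt' None).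
rewrite -(linext_ordinal_sum below_except_irr).
  congr linext; apply/setP => -[y|]; rewrite !inE //=.
  by rewrite (mem_imset _ _ (@Some_inj _)) !inE; apply/negb_inj; rewrite !negbK.
by move=> a b; rewrite inE => /eqP-> /imsetP[y]; rewrite !inE => yx ->; rewrite /= yx.
Qed.

(** Only [None] and [Some x] can come first. After [None] the old poset remains; after [Some x] the
    element [None] must follow, leaving the old poset without [x]. *)
Lemma linext_below : linext lt' setT = linext lt setT + linext lt [set~ x].
Proof.
have minE u : minl lt' [set~ Some x] u = (u == None).
  rewrite /minl !inE; case: u => [y|] /=; last by apply/forall_inP => -[].
  apply/negP => /andP[yx /forall_inP/(_ None)]; rewrite !inE /= => /(_ isT).
  by rewrite negbK => /eqP yE; rewrite yE eqxx in yx.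
have -> : setT = Some x |: [set~ Some x] by rewrite setUCr.
rewrite (linext_recU1 below_except_irr) ?inE ?eqxx //; last first.
  by move=> c; rewrite minE => /eqP->.
rewrite (eq_bigl _ _ minE) big_pred1_eq linext_below_delSome addnC; congr (_ + _).
  rewrite -linext_below_delNone; congr linext; apply/setP => u.
  by rewrite !inE; case: (u == Some x) / eqP => [->|]; rewrite ?andbT.
suff -> : [forall c in [set~ Some x], ~~ lt' c (Some x)] by rewrite mul1n.
by apply/forall_inP => -[y|] /=; rewrite ?eqxx ?min_x.
Qed.
End BelowExcept.

Lemma realizable_addr (n a b : nat) : realizable n a b -> realizable n.+1 (a + b) b.
Proof.
move=> [T [lt [x [irr tr minx cT [pos eq_e]]]]].
exists (option T), (below_except lt x), (Some x); split.
- exact: below_except_irr.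
- exact: below_except_trans.
- by case=> [y|] /=; rewrite ?minx ?eqxx.
- by rewrite card_option cT.
- by rewrite linext_below ?linext_below_delSome // mulnDl eq_e mulnDr.
Qed.

(** The new element becomes the distinguished one, and deleting it returns the old poset. *)
Lemma realizable_swap (n a b : nat) :
  0 < a -> realizable n a b -> realizable n.+1 (a + b) a.
Proof.
move=> a_gt0 [T [lt [x [irr tr minx cT [pos eq_e]]]]].
exists (option T), (below_except lt x), None; split.
- exact: below_except_irr.
- exact: below_except_trans.
- by case=> [y|] /=.
- by rewrite card_option cT.
- rewrite linext_below ?linext_below_delNone // mulnDl mulnDr eq_e; split=> //.
  have : 0 < linext lt setT * b by rewrite eq_e muln_gt0 pos a_gt0.
  by rewrite muln_gt0 => /andP[].
Qed.

(* [P] is placed on top of the dual of [Q], the two copies of the distinguished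
   element being identified with [inl x]; [inr x'] is an isolated dummy. *)
Definition glue_rel (T U : finType) (lt : rel T) (lt' : rel U) (x : T) (x' : U) :
    rel (T + U) :=
  fun u v => match u, v with
  | inl y, inl z => lt y z
  | inr y, inr z => [&& y != x', z != x' & lt' z y]
  | inr y, inl z => (y != x') && ((z != x) || lt' x' y)
  | inl _, inr _ => false
  end.

Lemma nu_size_glue (n1 n2 a1 a2 c d : nat) : 0 < c ->
  realizable n1 a1 c -> realizable n2 a2 c -> a1 + a2 = d + c ->
  nu_size c d (n1 + n2).-1.
Proof.
move=> c_gt0 [T [lt [x [irr tr minx cT [pos eq_e]]]]].
move=> [U [lt' [x' [irr' tr' minx' cU [pos' eq_e']]]]] eq_ad.
pose r := glue_rel lt lt' x x'.
have r_irr : irreflexive r by case=> y /=; rewrite ?irr // irr' !andbF.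
have r_tr : transitive r.
  case=> y [z|z] [t|t] //=; first exact: tr.
  - move=> /andP[zx' yz] lyt; rewrite zx' /=; apply/orP; left.
    by apply: contraTneq lyt => ->; exact: minx.
  - move=> /and3P[zx' yx' lyz] /andP[_ h]; rewrite zx' /=.
    by case/orP: h => [->//|lx]; rewrite (tr' _ _ _ lx lyz) orbT.
  - move=> /and3P[zx' yx' lyz] /and3P[_ tx' lty].
    by rewrite zx' tx' (tr' _ _ _ lty lyz).
pose A : {set T + U} := inr @: [set~ x']; pose B : {set T + U} := inl @: [set~ x].
pose p : T + U := inl x.
have pA : p \notin A by apply/imsetP => -[].
have pB : p \notin B.
  by apply/imsetP => -[y]; rewrite !inE => yx [xy]; rewrite xy eqxx in yx.
have inl_inj : injective (@inl T U) by move=> y z [].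
have eB : linext r B = linext lt [set~ x].
  by apply: linext_imset => //; exact: in2W.
have epB : linext r (p |: B) = linext lt setT.
  have -> : p |: B = inl @: setT.
    apply/setP => u; apply/setU1P/imsetP => [[->|/imsetP[y _ ->]]|[y _ ->]].
    - by exists x.
    - by exists y.
    - have [->|yx] := eqVneq y x; first by left.
      by right; apply: imset_f; rewrite !inE.
  by apply: linext_imset => //; exact: in2W.
have eA : linext r A = linext lt' [set~ x'].
  rewrite -[RHS]linext_rev; apply: linext_imset => // [y z _ _ []|y z] //.
  by rewrite !inE /r /= => -> ->.
have epA : linext r (p |: A) = linext lt' setT.
  (* [h] embeds the second poset, dualized, with [x'] sent to the shared element [inl x]. *)
  pose h u : T + U := if u == x' then inl x else inr u.
  have -> : p |: A = h @: setT.
    apply/setP => u; apply/setU1P/imsetP => [[->|/imsetP[y +  ->]]|[y _ ->]].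
    - by exists x' => //; rewrite /h eqxx.
    - by rewrite !inE => yx'; exists y; rewrite /h ?(negPf yx').
    - rewrite /h; case: eqVneq => [_|yx']; first by left.
      by right; apply: imset_f; rewrite !inE.
  rewrite -[RHS]linext_rev; apply: linext_imset => // y z _ _.
    by rewrite /h; do 2 case: eqVneq => [->|?] //; case.
  rewrite /h /r; case: (eqVneq y x') => [->|yx']; case: (eqVneq z x') => [->|zx'] /=.
  - by rewrite irr irr'.
  - by rewrite (negPf (minx' _)).
  - by rewrite yx' eqxx.
  - by rewrite yx' zx'.
have glueE := @linext_glue _ r r_irr A B p.
rewrite eA eB epA epB in glueE.
have ABlt a b : a \in A -> b \in B -> r a b && ~~ r b a.
  by move=> /imsetP[y + ->] /imsetP[z + ->]; rewrite !inE /r /= => -> ->.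
have {}glueE : linext r (p |: (A :|: B)) + linext lt' [set~ x'] * linext lt [set~ x]
  = linext lt' setT * linext lt [set~ x] + linext lt' [set~ x'] * linext lt setT.
  apply: glueE => // a /imsetP[y _ ->]; rewrite /r //=.
have pAB : p \notin A :|: B by rewrite inE negb_or pA.
have [|P [q [cP eP eQ]]] := @finPOrder_of_rel _ r (p |: (A :|: B)) p r_irr r_tr.
  by rewrite !inE eqxx.
rewrite setU1K // (linext_ordinal_sum r_irr ABlt) eA eB in eQ.
exists _, P, q; split.
  have cAB : #|A :&: B| = 0.
    by apply: eq_card0 => u; rewrite inE; apply/andP => -[/imsetP[y _ ->] /imsetP[]].
  rewrite cP cardsU1 pAB cardsU cAB subn0 !card_imset //; last by move=> y z [].
  have := cardsC1 x; have := cardsC1 x'; rewrite cT cU => -> ->.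
  have : 0 < n1 by rewrite -cT; apply/card_gt0P; exists x.
  have : 0 < n2 by rewrite -cU; apply/card_gt0P; exists x'.
  by lia.
rewrite /rho eP eQ; apply/eqP.
rewrite eqr_div ?pnatr_eq0 -?lt0n ?muln_gt0 ?pos ?pos' //.
rewrite -!natrM eqr_nat; apply/eqP.
move: (linext r _) glueE => e glueE.
move: (linext lt setT) (linext lt [set~ x]) (linext lt' setT) (linext lt' [set~ x'])
  eq_e eq_e' glueE => e1 f1 e2 f2 eq1 eq2 glueE.
(* Multiplying the gluing identity by [c] and inserting both ratios gives [e * c + f1 * f2 * c = f1
   * f2 * (a1 + a2)], and [a1 + a2 = d + c]. *)
have e2c : e2 * f1 * c = f1 * (e2 * c) by lia.
have e1c : f2 * e1 * c = f2 * (e1 * c) by lia.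
have := congr1 (muln^~ c) glueE; rewrite /= !mulnDl e2c e1c eq1 eq2.
have -> : f1 * (f2 * a2) + f2 * (f1 * a1) = f2 * f1 * (a1 + a2) by lia.
by rewrite eq_ad; lia.
Qed.

(** * Partial quotients and small multiples *)

(* The multiplier [s] is either [1] or [c.-1]: it stands for a sign modulo [c]. *)
Definition near (c s q k a : nat) : bool :=
  (0 < (s * q * a) %% c) && (k * q * ((s * q * a) %% c) <= c).

(** This dominates a sum of partial quotients truncated at [T]; the cutoff [Q] lets each Euclidean
    step be charged to its own denominator. *)
Definition weight (c T a Q : nat) : nat :=
  \sum_(Q <= q < c.+1) \sum_(1 <= k < T.+1) (near c 1 q k a + near c c.-1 q k a).

Lemma realizable_addM (u n a b : nat) :
  realizable n a b -> realizable (n + u) (a + u * b) b.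
Proof.
move=> h; elim: u => [|u /realizable_addr]; first by rewrite mul0n !addn0.
by rewrite addnS mulSn addnA addnAC.
Qed.

Lemma realizable_mul (k b : nat) : 0 < k -> realizable k (k * b) b.
Proof.
case: k => // k _; rewrite mulSn -add1n; apply: realizable_addM.
exact: realizable_one.
Qed.

Lemma leq_weight (c T a Q Q' : nat) : Q <= Q' -> weight c T a Q' <= weight c T a Q.
Proof.
move=> leQ; rewrite /weight; have [leQ'|ltQ'] := leqP Q' c.+1.
  by rewrite (big_cat_nat leQ leQ') /= leq_addl.
by rewrite big_geq // ltnW.
Qed.

(** Being [near] for [k] implies it for all smaller values, so the single denominator [q]
    contributes at least [k]. *)
Lemma weight_ge (c T a s q k : nat) : s = 1 \/ s = c.-1 -> 0 < q -> q <= c -> k <= T ->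
  near c s q k a -> k + weight c T a q.+1 <= weight c T a q.
Proof.
move=> sE q_gt0 leqc lekT /andP[r_gt0 ler].
have nearj j : j <= k -> near c s q j a.
  by move=> lej; rewrite /near r_gt0 (leq_trans _ ler) // !leq_mul.
rewrite [in leqRHS]/weight big_ltn ?ltnS // leq_add2r.
rewrite (@big_cat_nat _ _ _ k.+1) //= (leq_trans _ (leq_addr _ _)) //.
rewrite -[X in X <= _]muln1 -[X in X * 1]subn0 -subSS -sum_nat_const_nat.
rewrite big_nat [leqRHS]big_nat; apply: leq_sum => j /andP[_ lej].
by have := nearj j lej; case: sE => -> ->; rewrite ?leq_addr ?leq_addl.
Qed.

Section Euclid.
Variables (c T a : nat).
Hypothesis small_quotients :
  forall q, 0 < q -> ~~ near c 1 q T.+1 a && ~~ near c c.-1 q T.+1 a.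

(** [small_quotients] excludes [k > T], so the truncation loses nothing. *)
Lemma quotient_weight (s q r k : nat) : s = 1 \/ s = c.-1 -> 0 < q ->
    (s * q * a) %% c = r -> 0 < r -> k * q * r <= c ->
  k + weight c T a q.+1 <= weight c T a q.
Proof.
move=> sE q_gt0 rE r_gt0 lec.
have [k0|k_gt0] := posnP k; first by rewrite k0 add0n leq_weight.
have leqc : q <= c.
  by apply: leq_trans lec; rewrite mulnAC leq_pmull // muln_gt0 k_gt0.
apply: (@weight_ge c T a s) => //; last by rewrite /near rE r_gt0.
rewrite leqNgt; apply/negP => ltTk; have /andP[n1 n2] := small_quotients q_gt0.
have : near c s q T.+1 a by rewrite /near rE r_gt0 (leq_trans _ lec) // !leq_mul.
by case: sE => ->; apply/negP.
Qed.

(* The invariant [q * r' + q' * r = c] of the Euclidean algorithm shows that the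
   next partial quotient [k = r' %/ r] satisfies [k * q * r <= c], so that it is
   paid for by the pairs [(q, 1), ..., (q, k)] counted in the weight. *)
Lemma realizable_euclid (s s' q q' r r' : nat) :
    (s = 1 /\ s' = c.-1) \/ (s = c.-1 /\ s' = 1) ->
    0 < q' -> q' <= q -> 0 < r -> r <= r' -> r' < c ->
    (s * q * a) %% c = r -> (s' * q' * a) %% c = r' -> q * r' + q' * r = c ->
  exists2 n, n <= weight c T a q & realizable n r' r.
Proof.
have [m] := ubnP r; elim: m s s' q q' r r' => // m IHm s s' q q' r r' ltrm sE.
move=> q'_gt0 leq r_gt0 ler ltc rE r'E inv.
have k_gt0 : 0 < r' %/ r by rewrite divn_gt0.
have ltm0 : r' %% r < r by rewrite ltn_pmod.
have r'D := divn_eq r' r.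
move: (r' %/ r) (r' %% r) k_gt0 ltm0 r'D => k t k_gt0 ltt r'D.
rewrite {}r'D in ler ltc r'E inv *.
have lek : k * q * r <= c by rewrite -inv mulnDr mulnCA mulnA -addnA leq_addr.
have q_gt0 : 0 < q := leq_trans q'_gt0 leq.
have sE1 : s = 1 \/ s = c.-1 by case: sE => -[-> _]; [left|right].
have wk := quotient_weight sE1 q_gt0 rE r_gt0 lek.
have [t0|t_gt0] := posnP t.
  exists k; first by apply: leq_trans wk; rewrite leq_addr.
  by rewrite t0 addn0; apply: realizable_mul.
have ss' : s + s' = c by case: sE => -[-> ->]; lia.
have ltkq : q < q' + k * q.
  by apply: leq_ltn_trans (leq_pmull q k_gt0) _; rewrite -[ltnLHS]add0n ltn_add2r.
have [||||||||||n len rn] := IHm s' s (q' + k * q) q t r.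
- by apply: leq_trans ltt _; rewrite -ltnS.
- by case: sE => -[-> ->]; [right|left].
- exact: q_gt0.
- exact: ltnW.
- exact: t_gt0.
- exact: ltnW.
- apply: leq_trans ltc; rewrite ltnS.
  by apply: leq_trans (leq_addr _ _); rewrite leq_pmull.
- have lttc : t < c by apply: leq_ltn_trans ltc; exact: leq_addl.
  rewrite -[RHS](modn_small lttc); apply/eqP.
  (* After adding [k * r], the two sides differ by [k * q * a * (s + s')], a multiple of [c]. *)
  rewrite -(eqn_modDr (k * r)).
  have modE x : x + k * r = x + k * (s * q * a) %[mod c].
    by rewrite -[in LHS]rE -modnDmr modnMmr modnDmr.
  rewrite modE.
  have -> : s' * (q' + k * q) * a + k * (s * q * a)
    = s' * q' * a + k * q * a * (s + s') by lia.
  by rewrite ss' addnC modnMDl r'E [t + _]addnC modn_small.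
- exact: rE.
- by rewrite -inv; lia.
exists (n + k).
  apply: leq_trans wk; rewrite addnC leq_add2l (leq_trans len) // leq_weight //.
(* One swap turns [r / t] into [(r + t) / r], and [k - 1] additions complete the partial quotient
   [k]. *)
have := realizable_addM k.-1 (realizable_swap r_gt0 rn).
have -> : n.+1 + k.-1 = n + k by lia.
suff -> : r + t + k.-1 * r = k * r + t by [].
by case: (k) k_gt0 => // k' _; lia.
Qed.

(** The division of [c] by [a] is done separately, as the recursion needs [r' < c]. Its quotient [k]
    may be [1], in which case the next step is charged to the same denominator; hence the factor
    [2]. *)
Lemma realizable_lt : 0 < a < c ->
  exists2 n, n <= 2 * weight c T a 1 & realizable n c a.
Proof.
move=> /andP[a_gt0 ltac].
pose k := c %/ a; have k_gt0 : 0 < k by rewrite divn_gt0 // ltnW.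
have cD : c = k * a + c %% a := divn_eq c a.
have aE : (1 * 1 * a) %% c = a by rewrite !mul1n modn_small.
have wk : k + weight c T a 2 <= weight c T a 1.
  apply: quotient_weight aE a_gt0 _ => //; first by left.
  by rewrite muln1 leq_trunc_div.
have {}wk : k <= weight c T a 1 by apply: leq_trans wk; rewrite leq_addr.
have [r0|r_gt0] := posnP (c %% a).
  exists k; first by apply: leq_trans wk _; rewrite leq_pmull.
  by rewrite [X in realizable _ X _]cD r0 addn0; exact: realizable_mul.
have ltra : c %% a < a by rewrite ltn_pmod.
have [|||||||||n len rn] := @realizable_euclid c.-1 1 k 1 (c %% a) a.
- by right.
- by [].
- by [].
- by [].
- exact: ltnW.
- by [].
- have ltrc := ltn_trans ltra ltac.
  rewrite -[RHS](modn_small ltrc); apply/eqP.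
  rewrite -(eqn_modDr (k * a)) [X in _ == X %[mod _]]addnC -cD.
  have -> : c.-1 * k * a + k * a = (k * a) * c by case: (c) ltac => // c' _; lia.
  by rewrite modnMl modnn.
- exact: aE.
- by rewrite mul1n -cD.
exists (n + k); first by rewrite mul2n -addnn leq_add // (leq_trans len) // leq_weight.
have := realizable_addM k.-1 (realizable_swap a_gt0 rn).
have -> : n.+1 + k.-1 = n + k by lia.
suff -> : a + c %% a + k.-1 * a = c by [].
by rewrite [RHS]cD; case: (k) k_gt0 => // k' _; lia.
Qed.
End Euclid.

(** With [g = gcdn m c], every multiple of [g] modulo [c] is attained [g] times, and at most [M / g]
    positive ones are at most [M]. *)
Lemma count_small_multiples (c m M : nat) : 0 < c ->
  \sum_(0 <= a < c) ((0 < (m * a) %% c) && ((m * a) %% c <= M)) <= M.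
Proof.
move=> c_gt0; pose g := gcdn m c; pose c' := c %/ g.
have g_gt0 : 0 < g by rewrite gcdn_gt0 c_gt0 orbT.
have cE : c' * g = c by rewrite divnK // dvdn_gcdr.
pose P a := (0 < (m * a) %% c) && ((m * a) %% c <= M).
have -> : \sum_(0 <= a < c) P a = size [seq a <- index_iota 0 c | P a].
  by rewrite size_filter -sumn_count sumnE big_map.
(* the [g] solutions of [m * a = r] modulo [c] are told apart by [a %/ c'] *)
pose f a := (m * a) %% c - a %/ c'.
have c'_gt0 : 0 < c' by move: c_gt0; rewrite -cE muln_gt0 => /andP[].
have dvr a : g %| (m * a) %% c.
  by rewrite /dvdn (modn_dvdm _ (dvdn_gcdr m c)); apply: dvdn_mulr; exact: dvdn_gcdl.
have ltag a : a < c -> a %/ c' < g by rewrite ltn_divLR // mulnC cE.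
have ger a : P a -> g <= (m * a) %% c by case/andP => /dvdn_leq + _; exact.
rewrite -(size_map f) -[leqRHS](size_iota 1); apply: uniq_leq_size; last first.
  move=> x /mapP[a]; rewrite mem_filter mem_index_iota => /andP[Pa ltac] ->.
  rewrite mem_iota /f subn_gt0 (leq_trans (ltag a ltac) (ger a Pa)) /=.
  rewrite add1n ltnS leq_subLR; case/andP: Pa => _ /leq_trans.
  by apply; rewrite leq_addl.
rewrite map_inj_in_uniq ?filter_uniq ?iota_uniq // => a b.
rewrite !mem_filter !mem_index_iota => /andP[Pa ltac] /andP[Pb ltbc] fab.
have la := ltag a ltac; have lb := ltag b ltbc.
have ga := ger a Pa; have gb := ger b Pb.
have fab' : (m * a) %% c + b %/ c' = (m * b) %% c + a %/ c'.
  by move: fab; rewrite /f; lia.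
(* Both residues vanish modulo [g], while the two quotients are below [g]. *)
have eqdiv : a %/ c' = b %/ c'.
  have := congr1 (modn^~ g) fab'; rewrite /= -modnDml (eqP (dvr a)) add0n.
  by rewrite -[RHS]modnDml (eqP (dvr b)) add0n !modn_small.
move: fab'; rewrite eqdiv => /addIn eqm.
have eqmod : a = b %[mod c'].
  apply/eqP; have : m * a == m * b %[mod c] by apply/eqP.
  wlog leab : a b {Pa Pb fab la lb ga gb eqdiv eqm ltac ltbc} / a <= b.
    move=> h; case/orP: (leq_total a b) => [/h//|/h]; rewrite eq_sym => h1 /h1.
    by rewrite eq_sym.
  rewrite [_ == m * b %[mod c]]eq_sym [_ == b %[mod c']]eq_sym.
  rewrite !eqn_mod_dvd ?leq_mul // -mulnBr => dv.
  have cop : coprime c' (m %/ g).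
    rewrite coprime_sym /coprime -(eqn_pmul2r g_gt0) muln_gcdl mul1n.
    by rewrite !divnK ?dvdn_gcdl ?dvdn_gcdr.
  rewrite -(Gauss_dvdr _ cop) -(dvdn_pmul2r g_gt0) cE mulnAC divnK ?dvdn_gcdl //.
by rewrite (divn_eq a c') (divn_eq b c') eqdiv eqmod.
Qed.

Lemma count_near (c s q k : nat) : 0 < c -> 0 < q -> 0 < k ->
  \sum_(0 <= a < c) near c s q k a <= c %/ (k * q).
Proof.
move=> c_gt0 q_gt0 k_gt0.
apply: leq_trans (count_small_multiples (s * q) (c %/ (k * q)) c_gt0).
apply: leq_sum => a _; rewrite /near leq_divRL ?muln_gt0 ?k_gt0 //.
by rewrite [k * q * _]mulnC.
Qed.

(** * Most residues have small partial quotients *)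

Definition large_quotient (c T a : nat) : bool :=
  has (fun q => near c 1 q T.+1 a || near c c.-1 q T.+1 a) (index_iota 1 c.+1).

(** A denominator above [c] is never [near], since the residue is positive; the search up to [c] is
    therefore exhaustive. *)
Lemma large_quotientPn (c T a q : nat) : ~~ large_quotient c T a -> 0 < q ->
  ~~ near c 1 q T.+1 a && ~~ near c c.-1 q T.+1 a.
Proof.
move=> /hasPn h q_gt0; rewrite -negb_or; have [leqc|ltcq] := leqP q c.
  by apply: h; rewrite mem_index_iota q_gt0.
have far s : ~~ near c s q T.+1 a.
  rewrite /near negb_and -eqn0Ngt; case: posnP => //= r_gt0.
  by rewrite -ltnNge (leq_trans ltcq) // mulnAC leq_pmull // muln_gt0.
by rewrite negb_or !far.
Qed.

(** Otherwise each [a] below the minimum makes [a] or [m - a] bad. Both maps are injective modulo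
    [c] on that range, so each bad residue is charged at most twice. *)
Lemma pigeonhole_sum (bad : nat -> bool) (c m : nat) : 0 < c ->
  2 * \sum_(0 <= a < c) bad a < minn m.+1 c ->
  exists a, [/\ a < c, a <= m, ~~ bad a & ~~ bad ((m - a) %% c)].
Proof.
move=> c_gt0; set N := minn _ _ => lt2.
have leNm : N <= m.+1 := geq_minl _ _; have leNc : N <= c := geq_minr _ _.
case: (boolP (has (fun a => ~~ bad a && ~~ bad ((m - a) %% c)) (index_iota 0 N))).
  case/hasP => a; rewrite mem_index_iota /= => ltaN /andP[b1 b2].
  exists a; split => //; first exact: leq_trans ltaN leNc.
  by rewrite -ltnS (leq_trans ltaN).
move=> /hasPn h.
have cntE (s : seq nat) : \sum_(a <- s) bad a = size (filter bad s).
  by rewrite size_filter -sumn_count sumnE big_map.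
suff : N <= 2 * \sum_(0 <= a < c) bad a by rewrite leqNgt lt2.
have leN : N <= \sum_(0 <= a < N) (bad a + bad ((m - a) %% c)).
  rewrite -{1}[N]subn0 -[X in X <= _]muln1 -sum_nat_const_nat.
  rewrite big_seq [X in _ <= X]big_seq; apply: leq_sum => a ai; move: (h a ai).
  by rewrite -negb_or negbK; case: (bad a) => //= ->.
apply: leq_trans leN _; rewrite big_split /= mul2n -addnn leq_add //.
  by rewrite (big_cat_nat (leq0n N) leNc) /= leq_addr.
rewrite -(big_map (fun a => (m - a) %% c) xpredT (fun b => bad b : nat)) !cntE.
apply: uniq_leq_size => [|b]; last first.
  rewrite !mem_filter => /andP[-> /mapP[a _ ->]].
  by rewrite mem_index_iota ltn_pmod.
rewrite filter_uniq // map_inj_in_uniq ?iota_uniq // => a b.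
rewrite !mem_index_iota /= => ltaN ltbN /eqP.
wlog leab : a b ltaN ltbN / a <= b.
  move=> h'; case/orP: (leq_total a b) => [/h'|/h' h'']; first exact.
  by rewrite eq_sym => /h'' ->.
have lebm : b <= m by rewrite -ltnS (leq_trans ltbN).
rewrite eqn_mod_dvd ?leq_sub2l //; have -> : m - a - (m - b) = b - a by lia.
have ltc : b - a < c by apply: leq_ltn_trans (leq_subr _ _) (leq_trans ltbN leNc).
by rewrite /dvdn modn_small // subn_eq0 => leba; apply/eqP; rewrite eqn_leq leab.
Qed.

Local Open Scope ring_scope.

Section Estimates.
Variable R : realType.
Implicit Types (c T a : nat) (K : R).

Definition harm (n : nat) : R := \sum_(1 <= k < n.+1) k%:R^-1.

Lemma harm_le (n : nat) : (0 < n)%N -> harm n <= 1 + ln n%:R.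
Proof.
elim: n => // n IHn _; have [->|n_gt0] := posnP n.
  by rewrite /harm big_nat1 invr1 ln1 addr0.
rewrite /harm big_nat_recr //= -/(harm n).
have nR : 0 < n%:R :> R by rewrite ltr0n.
have n1R : 0 < n.+1%:R :> R by rewrite ltr0n.
(* [ln (1 + x) <= x] at this point bounds the new term by [ln (n + 1) - ln n]. *)
have := @le_ln1Dx R (- n.+1%:R^-1).
have -> : 1 + - n.+1%:R^-1 = n%:R / n.+1%:R :> R.
  by rewrite -natr1; field; rewrite natr1 gt_eqF.
rewrite ltrN2 invf_lt1 // ltr1n ltnS n_gt0 => /(_ isT).
rewrite ln_div ?posrE // => h; move: (IHn n_gt0) => h0.
move: (harm n) (ln n%:R) (ln n.+1%:R) (n.+1%:R^-1) h h0 => s u v w h h0; lra.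
Qed.

Lemma natr_divn_le (c k q : nat) : (0 < k)%N -> (0 < q)%N ->
  (c %/ (k * q))%:R <= c%:R * (k%:R^-1 * q%:R^-1) :> R.
Proof.
move=> k_gt0 q_gt0; rewrite -invfM -natrM ler_pdivlMr ?ltr0n ?muln_gt0 ?k_gt0 //.
by rewrite -natrM ler_nat leq_trunc_div.
Qed.

Lemma sum_weight c T : (0 < c)%N ->
  (\sum_(0 <= a < c) weight c T a 1)%:R <= 2 * c%:R * harm c * harm T.
Proof.
move=> c_gt0; rewrite /weight exchange_big_nat /=.
under eq_bigr do rewrite exchange_big_nat /=.
rewrite natr_sum /harm -mulrA mulr_suml mulr_sumr big_nat [leRHS]big_nat.
apply: ler_sum => q /andP[q_gt0 _]; rewrite natr_sum !mulr_sumr big_nat [leRHS]big_nat.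
apply: ler_sum => k /andP[k_gt0 _]; rewrite big_split natrD /=.
have h s : (\sum_(0 <= i < c) near c s q k i)%:R <= c%:R * (k%:R^-1 * q%:R^-1) :> R.
  by apply: le_trans (natr_divn_le _ k_gt0 q_gt0); rewrite ler_nat count_near.
by move: (lerD (h 1%N) (h c.-1)) => h0; lra.
Qed.

Lemma sum_large_quotient c T : (0 < c)%N ->
  (\sum_(0 <= a < c) large_quotient c T a)%:R <= 2 * c%:R * harm c / T.+1%:R.
Proof.
move=> c_gt0.
pose Z a := (\sum_(1 <= q < c.+1) (near c 1 q T.+1 a + near c c.-1 q T.+1 a))%N.
have le1 : (\sum_(0 <= a < c) large_quotient c T a <= \sum_(0 <= a < c) Z a)%N.
  apply: leq_sum => a _; case: (boolP (large_quotient c T a)) => // /hasP[q qi h].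
  rewrite /Z (bigD1_seq q) ?iota_uniq //= (leq_trans _ (leq_addr _ _)) //.
  by case/orP: h => ->; rewrite ?leq_addr ?leq_addl.
apply: (@le_trans _ _ (\sum_(0 <= a < c) Z a)%N%:R); first by rewrite ler_nat.
rewrite /Z exchange_big_nat /= natr_sum /harm -!mulrA mulr_suml !mulr_sumr.
rewrite big_nat [leRHS]big_nat.
apply: ler_sum => q /andP[q_gt0 _]; rewrite big_split natrD /=.
have h s :
    (\sum_(0 <= i < c) near c s q T.+1 i)%:R <= c%:R * (T.+1%:R^-1 * q%:R^-1) :> R.
  by apply: le_trans (natr_divn_le _ _ q_gt0) => //; rewrite ler_nat count_near.
apply: le_trans (lerD (h 1%N) (h c.-1)) _.
by rewrite [q%:R^-1 * _]mulrC [2 * _]mulr_natl mulr2n.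
Qed.

(** A Markov threshold: for [T <= K * H] the mean weight is at most [2 * H * (1 + ln (K * H))],
    which is [2 / K] times this bound. *)
Definition cf_bound c K : R :=
  let H := 1 + ln c%:R in K * H * (1 + ln (K * H)).

Definition bad c K a : bool :=
  let T := Num.truncn (K * (1 + ln c%:R)) in
  large_quotient c T a || (cf_bound c K < (weight c T a 1)%:R).

Lemma ln_nat_ge0 c : 0 <= ln c%:R :> R.
Proof. by case: c => [|c]; [rewrite ln0 | rewrite ln_ge0 // ler1n]. Qed.

(** Large quotients exclude at most [2 * c / K] residues because [T + 1 > K * H]; Markov's
    inequality excludes as many again. *)
Lemma sum_bad c K : (0 < c)%N -> 1 <= K ->
  (\sum_(0 <= a < c) bad c K a)%:R <= 4 * c%:R / K.
Proof.
move=> c_gt0 K1; rewrite /bad /cf_bound; set H := 1 + ln c%:R; set T := Num.truncn _.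
have H1 : 1 <= H by rewrite /H lerDl ln_nat_ge0.
have KH1 : 1 <= K * H by rewrite -[1]mulr1 ler_pM.
have T_gt0 : (0 < T)%N by rewrite truncn_gt0.
have /andP[leT ltT] : T%:R <= K * H < T.+1%:R by apply: truncn_itv; lra.
have L1 : 0 <= ln (K * H) by rewrite ln_ge0.
have harmc : harm c <= H := harm_le c_gt0.
have harmT : harm T <= 1 + ln (K * H).
  apply: le_trans (harm_le T_gt0) _; rewrite lerD2l ler_ln ?posrE ?ltr0n //; lra.
have harm0 n : 0 <= harm n by apply: sumr_ge0 => k _; rewrite invr_ge0.
set X := K * H * _; have X_gt0 : 0 < X by rewrite mulr_gt0 //; lra.
have cR : 0 < c%:R :> R by rewrite ltr0n.
have b1 : (\sum_(0 <= a < c) large_quotient c T a)%:R <= 2 * c%:R / K.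
  apply: le_trans (sum_large_quotient T c_gt0) _.
  rewrite ler_pdivrMr ?ltr0n // -[X in _ <= X]mulrA [K^-1 * _]mulrC.
  rewrite ler_pM2l ?mulr_gt0 // ler_pdivlMr ?(lt_le_trans ltr01 K1) // mulrC.
  by apply: le_trans (ltW ltT); rewrite ler_pM2l ?(lt_le_trans ltr01 K1).
have b2 : (\sum_(0 <= a < c) (X < (weight c T a 1)%:R)%R)%:R <= 2 * c%:R / K.
  have : X * (\sum_(0 <= a < c) (X < (weight c T a 1)%:R)%R)%:R
      <= 2 * c%:R * harm c * harm T.
    apply: le_trans (sum_weight T c_gt0); rewrite !natr_sum mulr_sumr.
    apply: ler_sum => a _; case: ltP => [/ltW|_]; first by rewrite mulr1.
    by rewrite mulr0.
  rewrite mulrC -ler_pdivlMr // => /le_trans; apply.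
  rewrite ler_pdivrMr // /X.
  have -> : 2 * c%:R / K * (K * H * (1 + ln (K * H))) = 2 * c%:R * H * (1 + ln (K * H)).
    by field; lra.
  rewrite ler_pM // ?mulr_ge0 // ?ler_pM // ?mulr_ge0 //.
have -> : 4 * c%:R / K = 2 * c%:R / K + 2 * c%:R / K :> R by lra.
apply: le_trans (lerD b1 b2); rewrite -natrD -big_split ler_nat /=.
by apply: leq_sum => a _; case: (large_quotient _ _ _); case: ltP.
Qed.

Lemma not_bad_realizable c K a : (a < c)%N -> 1 <= K -> ~~ bad c K a ->
  exists2 n, n%:R <= 1 + 2 * cf_bound c K & realizable n (c + a) c.
Proof.
move=> ltac K1; rewrite negb_or -leNgt => /andP[/large_quotientPn small leX].
have [a0|a_gt0] := posnP a.
  exists 1%N; last by rewrite a0 addn0; exact: realizable_one.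
  by rewrite lerDl mulr_ge0 // (le_trans _ leX).
have [|n len rn] := @realizable_lt c _ a small; first by rewrite a_gt0.
exists n.+1; last by apply: realizable_swap rn; exact: leq_ltn_trans ltac.
rewrite -nat1r lerD2l (le_trans _ (ler_wpM2l _ leX)) // -natrM ler_nat.
exact: len.
Qed.

(** * Upper bounds for nu(c, d) *)

(** Write [d - c = a + b] with [a] and [b %% c] both good, and glue [1 + a / c] to [1 + b / c]. The
    integer part of [b / c] costs at most [d / c - 1] elements. *)
Lemma nu_size_bound c d K : (0 < c)%N -> (c <= d)%N -> 1 <= K ->
    8 * c%:R / K < (minn (d - c).+1 c)%:R ->
  exists2 n, nu_size c d n & n%:R <= d%:R / c%:R + 1 + 4 * cf_bound c K.
Proof.
move=> c_gt0 lecd K1 ltN.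
have cR : 0 < c%:R :> R by rewrite ltr0n.
have [|a [ltac leam nb1 nb2]] := @pigeonhole_sum (bad c K) c (d - c) c_gt0.
  rewrite -(ltr_nat R) natrM; apply: le_lt_trans ltN.
  by move: (sum_bad c_gt0 K1) => h0; lra.
have [n1 le1 r1] := not_bad_realizable ltac K1 nb1.
have [|n2 le2 r2] := not_bad_realizable _ K1 nb2; first by rewrite ltn_pmod.
have r3 := realizable_addM ((d - c - a) %/ c) r2.
have eqd : (c + a + (c + (d - c - a) %% c + (d - c - a) %/ c * c) = d + c)%N.
  by have := divn_eq (d - c - a) c; lia.
exists (n1 + (n2 + (d - c - a) %/ c)).-1; first exact: nu_size_glue r1 r3 eqd.
have leu : ((d - c - a) %/ c)%:R <= d%:R / c%:R - 1 :> R.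
  rewrite -[X in _ - X](divff (lt0r_neq0 cR)) -mulrBl ler_pdivlMr //.
  rewrite -natrB // -natrM ler_nat.
  by apply: leq_trans (leq_trunc_div _ _) (leq_subr _ _).
apply: (@le_trans _ _ (n1 + (n2 + (d - c - a) %/ c))%:R).
  by rewrite ler_nat leq_pred.
rewrite !natrD; lra.
Qed.

Lemma is_nu_le (c d n : nat) : nu_size c d n -> exists2 k, is_nu c d k & (k <= n)%N.
Proof.
move=> h; have ex : exists n, `[< nu_size c d n >] by exists n; apply/asboolP.
case: (ex_minnP ex) => k /asboolP hk mink; exists k; last by apply: mink; apply/asboolP.
by split => // m hm; apply: mink; apply/asboolP.
Qed.

Lemma ln4_ge1 : 1 <= ln 4 :> R.
Proof.
have := @le_ln1Dx R (- (1 / 2)).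
have -> : 1 + - (1 / 2) = 2^-1 :> R by lra.
rewrite lnV ?posrE ?ltr0n // => h; have {}h := h ltac:(lra).
have -> : 4 = 2 * 2 :> R by lra.
by rewrite lnM ?posrE ?ltr0n //; lra.
Qed.

Lemma ln5_gt1 : 1 < ln 5 :> R.
Proof.
by apply: le_lt_trans ln4_ge1 _; rewrite ltr_ln ?posrE ?ltr0n // ltr_nat.
Qed.

(** Division by [ln (ln 5)] absorbs the additive constant into [ln (ln (d + 3))], as [d >= 2]. The
    factor [10] is [2] from [H <= 2 * L] times [5] from [1 + 4 * X <= 5 * X]. *)
Definition asym_const K : R := 10 * K * ((1 + ln K + ln 2) / ln (ln 5) + 1).

Lemma cf_bound_asymptotic c d K : (0 < c)%N -> (c < d)%N -> 1 <= K ->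
  1 + 4 * cf_bound c K <= asym_const K * ln (d + 2)%:R * ln (ln (d + 3)%:R).
Proof.
move=> c_gt0 ltcd K1; rewrite /cf_bound /asym_const.
set H := 1 + ln c%:R; set L := ln (d + 2)%:R; set L3 := ln (d + 3)%:R.
have lnS (x y : nat) : (0 < x)%N -> (x <= y)%N -> ln x%:R <= ln y%:R :> R.
  by move=> x0 xy; rewrite ler_ln ?posrE ?ltr0n ?ler_nat // (leq_trans x0).
have H1 : 1 <= H by rewrite /H lerDl ln_nat_ge0.
have ln5 := ln5_gt1; have ln4 := ln4_ge1.
have L31 : ln 5 <= L3 by apply: (lnS 5); lia.
have L1 : 1 <= L by apply: le_trans ln4 _; apply: (lnS 4); lia.
have HL : H <= 2 * L by have : ln c%:R <= L by [apply: lnS; lia]; rewrite /H; lra.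
have HL3 : H <= 2 * L3 by have : ln c%:R <= L3 by [apply: lnS; lia]; rewrite /H; lra.
have mu0 : 0 < ln (ln 5) :> R by rewrite ln_gt0.
set mu := ln (ln 5) in mu0 *.
have muM : mu <= ln L3 by rewrite ler_ln ?posrE //; lra.
set M := ln L3 in muM *.
have lnH : ln H <= ln 2 + M.
  rewrite -lnM ?posrE ?ltr0n //; last lra.
  by rewrite ler_ln ?posrE //; lra.
have lnK : 0 <= ln K by rewrite ln_ge0.
have ln2 : 0 <= ln 2 :> R by rewrite ln_ge0 // ler1n.
have lnH0 : 0 <= ln H by rewrite ln_ge0.
rewrite lnM ?posrE; [|lra|lra].
have KH1 : 1 <= K * H by rewrite -[1]mulr1 ler_pM.
set D := 1 + ln K + ln 2.
have DM : D <= D / mu * M by rewrite mulrAC ler_pdivlMr // ler_wpM2l // /D; lra.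
have step1 : 1 + (ln K + ln H) <= (D / mu + 1) * M.
  by rewrite mulrDl mul1r; move: (D / mu * M) DM; rewrite /D => z DM; lra.
have X1 : 1 <= K * H * (1 + (ln K + ln H)) by rewrite -[1]mulr1 ler_pM //; lra.
have X2 : K * H * (1 + (ln K + ln H)) <= K * (2 * L) * ((D / mu + 1) * M).
  rewrite ler_pM //; [lra|lra|]; rewrite ler_pM2l //; lra.
have -> : 10 * K * (D / mu + 1) * L * M = 5 * (K * (2 * L) * ((D / mu + 1) * M)).
  by ring.
lra.
Qed.

Lemma asym_const_gt0 K : 1 <= K -> 0 < asym_const K.
Proof.
move=> K1; rewrite /asym_const mulr_gt0 //; first lra.
have lnK : 0 <= ln K by rewrite ln_ge0.
have ln2 : 0 <= ln 2 :> R by rewrite ln_ge0 // ler1n.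
by rewrite ltr_wpDl // divr_ge0 ?ln_ge0 ?(ltW ln5_gt1) //; lra.
Qed.

Lemma is_nu_bound (eps : R) : 0 < eps ->
  exists C : R, 0 < C /\
    forall c d : nat, (0 < c)%N -> (0 < d)%N ->
      (1 + eps) * c%:R <= d%:R ->
      exists n : nat, is_nu c d n /\
        n%:R <= d%:R / c%:R + C * ln (d + 2)%:R * ln (ln (d + 3)%:R).
Proof.
move=> eps_gt0; set mu := Num.min eps 1.
have mu0 : 0 < mu by rewrite lt_min eps_gt0 ltr01.
have mu1 : mu <= 1 by rewrite ge_min lexx orbT.
have mue : mu <= eps by rewrite ge_min lexx.
(* This choice makes [8 * c / K = mu * c / 2], which lies below both [c] and [d - c + 1]. *)
pose K := 16 / mu; have K1 : 1 <= K by rewrite ler_pdivlMr //; lra.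
exists (asym_const K); split=> [|c d c_gt0 _ led]; first exact: asym_const_gt0.
have cR : 0 < c%:R :> R by rewrite ltr0n.
have epsc : 0 < eps * c%:R by rewrite mulr_gt0.
have ltcd : (c < d)%N by rewrite -(ltr_nat R); lra.
have muc : mu * c%:R <= eps * c%:R by rewrite ler_pM2r.
have muc0 : 0 < mu * c%:R by rewrite mulr_gt0.
have muc1 : mu * c%:R <= c%:R by rewrite ler_piMl // ltW.
have [|n nun len] := @nu_size_bound c d K c_gt0 (ltnW ltcd) K1.
  have -> : 8 * c%:R / K = mu * c%:R / 2 by rewrite /K; field; rewrite gt_eqF.
  rewrite /minn; case: ltnP => _; last lra.
  by rewrite -[(d - c).+1%:R]natr1 natrB ?(ltnW ltcd) //; lra.
have [k nuk lek] := is_nu_le nun.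
exists k; split => //; apply: (@le_trans _ _ n%:R); first by rewrite ler_nat.
by apply: le_trans len _; rewrite -addrA lerD2l cf_bound_asymptotic.
Qed.
End Estimates.

Theorem theorem1p2 (R : realType) :
  (forall eps : R, 0 < eps ->
     exists C : R, 0 < C /\
       forall c d : nat, (0 < c)%N -> (0 < d)%N ->
         (1 + eps) * c%:R <= d%:R ->
         exists n : nat, is_nu c d n /\
           n%:R <= d%:R / c%:R + C * ln (d + 2)%:R * ln (ln (d + 3)%:R)) /\
  (exists C : R, 0 < C /\
     forall c d : nat, (0 < c)%N -> (0 < d)%N ->
       (2 * c <= d)%N ->
       exists n : nat, is_nu c d n /\
         n%:R <= d%:R / c%:R + C * ln (d + 2)%:R * ln (ln (d + 3)%:R)).
Proof.
split; first exact: is_nu_bound.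
(* The second claim is the case [eps = 1]. *)
have [C [C_gt0 bound]] := is_nu_bound (@ltr01 R).
exists C; split=> // c d c_gt0 d_gt0 le2c; apply: bound => //.
by rewrite -[1 + 1]/(2%:R) -natrM ler_nat.
Qed.
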